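(* Let $F = \{f_n\}_{n \in \mathbb{N}}$ be a family of Boolean functions. Let $L\colon \mathbb{N} \to \mathbb{N}$ be such that for each $n \in \mathbb{N}$, the lower bound $L(n)$ for $\mathrm{NBP}(f_n)$ or $\oplus\mathrm{BP}(f_n)$ has been obtained using the simple Nečiporuk lower bound method. Then $L(n) \in O\Bigl(\frac{n^{3/2}}{\log_2 n}\Bigr)$.
   Context: For an $n$-ary Boolean function $f$ and $V \subseteq [n]$, $r_V(f)$ denotes the number of distinct subfunctions $f|_\rho\colon\{0,1\}^V\to\{0,1\}$ obtained by fixing the variables outside $V$ by some $\rho \in \{0,1\}^{[n]\setminus V}$. A (nondeterministic) branching program (NBP) is a directed graph with a start vertex $s$, two sinks $t_0,t_1$, each non-sink vertex labelled by an input variable and arcs labelled $0$ or $1$; on input $a$ one keeps the arcs consistent with $a$; an NBP accepts iff there is a path from $s$ to $t_1$, and the same graph read as a parity branching program ($\oplus$BP) accepts iff the number of such paths is odd. $\mathrm{NBP}(f)$ and $\oplus\mathrm{BP}(f)$ denote the minimum number of non-sink vertices of an NBP, respectively $\oplus$BP, computing $f$. For $\mathbf{M} \in \{\mathrm{NBP}, \oplus\mathrm{BP}\}$, $\mathbf{M}_{sem}(n,s)$ is the number of distinct $n$-ary Boolean functions (on a fixed variable set) of complexity at most $s$ under $\mathbf{M}$. The simple Nečiporuk lower bound method for $\mathbf{M}$ consists of: (1) giving a non-decreasing $b\colon\mathbb{N}_{>0}\to\mathbb{N}$ such that for every $n$, every $n$-ary Boolean function $f$ on $V$ depending on all its inputs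 and every partition $V_1,\dots,V_p$ of $V$, $\sum_{i=1}^p \max\{|V_i|, \min\{s \in \mathbb{N} \mid \mathbf{M}_{sem}(|V_i|,s) \ge r_{V_i}(f)\}\} \ge \sum_{i=1}^p b(r_{V_i}(f))$ (such $b$ is a simple Nečiporuk function for $\mathbf{M}$); (2) for a given function $g$ depending on all variables in $V$, choosing a partition $V_1,\dots,V_p$ of $V$ and concluding $\mathbf{M}(g) \ge \sum_{i=1}^p b(r_{V_i}(g))$. *)

(* Defs.v *)
From mathcomp Require Import all_boot.
From mathcomp Require classical_sets.

Set Implicit Arguments.
Unset Strict Implicit.
Unset Printing Implicit Defensive.

Local Open Scope nat_scope.

(* Least element of [S]. The default 0 for empty [S] is never reached below:
   every Boolean function has an acyclic branching program, and the number of
   subfunctions on a set [V] is at most the number of functions on [#|V|]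
   variables. *)
Definition nat_min (S : nat -> Prop) : nat :=
  classical_sets.xget 0 (fun s => S s /\ forall s', S s' -> s <= s').

Notation assignment V := {ffun V -> bool}.
Notation boolfun V := {ffun {ffun V -> bool} -> bool}.

Section BranchingPrograms.
Variables (V : finType) (s : nat).

(* [inl i] are the [s] non-sink vertices, [inr b] is the sink t_b. *)
Definition vertex : Type := 'I_s + bool.

(* [arc i c v]: there is an arc labelled [c] from [inl i] to [v]. *)
Definition arc_rel (arc : 'I_s -> bool -> vertex -> bool) : rel vertex :=
  fun u v => if u is inl i then arc i false v || arc i true v else false.

(* Out-degrees are arbitrary. Acyclicity makes the number of paths finite; the
   start vertex may be a sink (constant functions). *)
Record program := Program {
  var : 'I_s -> V;
  start : vertex;
  arc : 'I_s -> bool -> vertex -> bool;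
  program_acyclic : forall c : seq vertex, cycle (arc_rel arc) c -> c = [::]
}.

Definition step (P : program) (a : assignment V) : rel vertex :=
  fun u v => if u is inl i then arc P i (a (var P i)) v else false.

(* As the graph is acyclic, a path has fewer arcs than there are vertices; on a
   given input at most one arc is kept between two vertices, so that a path is
   determined by its sequence of vertices. *)
Definition num_paths (P : program) (a : assignment V) : nat :=
  \sum_(k < #|{: vertex}|)
    #|[set p : k.-tuple vertex |
        path (step P a) (start P) p && (last (start P) p == inr true)]|.

End BranchingPrograms.

Inductive model := NBP | ParityBP.

Definition accepts (M : model) (V : finType) (s : nat) (P : program V s)
    (a : assignment V) : bool :=
  match M with
  | NBP => connect (step P a) (start P) (inr true)
  | ParityBP => odd (num_paths P a)
  end.

Definition complexity (M : model) (V : finType) (f : boolfun V) : nat :=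
  nat_min (fun s => exists P : program V s, forall a, accepts M P a = f a).

Definition semantic_count (M : model) (n s : nat) : nat :=
  #|[set f : boolfun 'I_n | complexity M f <= s]|.

Section Subfunctions.
Variables (n : nat) (f : boolfun 'I_n) (V : {set 'I_n}).

Definition merge (y : assignment {i | i \in V})
    (rho : assignment {i | i \notin V}) : assignment 'I_n :=
  [ffun i => match boolP (i \in V) with
             | AltTrue iV => y (exist _ i iV)
             | AltFalse iV => rho (exist _ i iV)
             end].

Definition subfunction (rho : assignment {i | i \notin V}) :
    boolfun {i | i \in V} :=
  [ffun y => f (merge y rho)].

Definition num_subfunctions : nat :=
  #|[set subfunction rho | rho : assignment {i | i \notin V}]|.

End Subfunctions.

Definition depends_on_all n (f : boolfun 'I_n) : Prop :=
  forall i, exists a a' : assignment 'I_n,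
    (forall j, j != i -> a j = a' j) /\ f a <> f a'.

(* Only the values of [b] at positive integers matter. *)
Definition simple_neciporuk_function (M : model) (b : nat -> nat) : Prop :=
  (forall m m', 0 < m -> m <= m' -> b m <= b m') /\
  (forall n (f : boolfun 'I_n) (P : {set {set 'I_n}}),
     depends_on_all f -> partition P [set: 'I_n] ->
     \sum_(V in P) b (num_subfunctions f V) <=
     \sum_(V in P)
       maxn #|V| (nat_min (fun s => num_subfunctions f V <=
                                    semantic_count M #|V| s))).

(* [l] is the lower bound on [complexity M g] given by the simple method. *)
Definition simple_neciporuk_bound (M : model) n (g : boolfun 'I_n) (l : nat) :
    Prop :=
  depends_on_all g /\
  exists b (P : {set {set 'I_n}}),
    [/\ simple_neciporuk_function M b, partition P [set: 'I_n] &
        l = \sum_(V in P) b (num_subfunctions g V)].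

(* Main.v *)
(* Every function of l variables has a branching program with O(2^(l/2))
   vertices and at most one accepting path per input (hence valid in both
   models): read the first half of the variables by a decision tree, guess the
   remaining bits by jumping to a leaf of a tree directed towards t_1, and check
   the guess on the way down to its root.  So 3 * 2^(uphalf l) vertices suffice
   to get 2^2^l functions.  With l about log n, applying the defining inequality
   of b to g itself bounds the contribution of a block of size v by
   O(max(v, 2^(min(v, l)/2))) = O(v * sqrt n / l), since a block has at most
   2^2^v and at most 2^n subfunctions; summing over the blocks gives
   O(n^(3/2) / log n). *)

Require Import Defs.
From mathcomp Require Import all_boot all_order all_algebra.
From mathcomp Require Import all_classical all_reals all_analysis.
From mathcomp Require Import zify.
Import Order.TTheory GRing.Theory Num.Theory.
Import numFieldNormedType.Exports.

Set Implicit Arguments.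
Unset Strict Implicit.
Unset Printing Implicit Defensive.

(** * Least elements and counting of paths by length *)

Lemma nat_min_le (S : nat -> Prop) s : S s -> nat_min S <= s.
Proof.
move=> Ss.
have exS : exists m, `[< S m >] by exists s; apply/asboolP.
have [m /asboolP Sm m_min] := ex_minnP exS.
have [_ ->//] : S (nat_min S) /\ forall s', S s' -> nat_min S <= s'.
apply: (@xgetPex _ 0 (fun s => S s /\ forall s', S s' -> s <= s')).
by exists m; split=> // s' Ss'; apply: m_min; apply/asboolP.
Qed.

(** Collapses the sum over path lengths in [num_paths] once the accepting path is known to be
    unique. *)
Lemma card_tuple_eq (T : finType) k (s : seq T) :
  #|[set p : k.-tuple T | p == s :> seq T]%SET| = (k == size s) :> nat.
Proof.
case: eqP => [Ek|ne_k].
  apply/eqP/cards1P; exists (tcast (esym Ek) (in_tuple s)).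
  by apply/finset.setP=> p; rewrite !inE -val_eqE /= val_tcast.
apply: eq_card0 => p; rewrite inE; apply/eqP=> Ep; apply: ne_k.
by rewrite -Ep size_tuple.
Qed.

(** * A program of size O(2^(l/2)) for an arbitrary function [F] of [l] variables *)

Section UniversalProgram.
Variables (X : finType) (l h : nat) (e : 'I_l -> X) (F : boolfun 'I_l).
Hypotheses (h_gt0 : 0 < h) (le_hl : h <= l).

(* A node of level i reads variable i. In the decision tree (i < h) it remembers
   the bits read so far, in the reversed tree (h <= i) the guessed bits of the
   variables from i on. *)
Definition known (i : nat) : pred 'I_l :=
  fun j => if i < h then j < i else i <= j.

(** Unknown bits are normalised to [false], so that each partial assignment has one representative
    and gives one node. *)
Definition mask i (a : assignment 'I_l) : assignment 'I_l :=
  [ffun j => a j && known i j].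

Definition node_set : {set 'I_l * assignment 'I_l} :=
  [set x : 'I_l * assignment 'I_l | x.2 == mask x.1 x.2]%SET.

Local Notation vtx := (vertex #|node_set|).

(* t_1 serves as the root of the reversed tree; t_0 is given the unreachable
   level l.+1, so that a vertex is determined by its level and state. *)
Definition level (u : vtx) : nat :=
  match u with inl k => (enum_val k).1 | inr b => if b then l else l.+1 end.

Definition state (u : vtx) : assignment 'I_l :=
  if u is inl k then (enum_val k).2 else [ffun=> false].

Definition glue i (w : assignment 'I_l) c (w' : assignment 'I_l) :
    assignment 'I_l :=
  [ffun j : 'I_l => if j < i then w j else if j == i :> nat then c else w' j].

(** In the decision tree an arc appends the bit just read. The arcs into level [h] jump to every
    guess that makes [F] true; only here does [F] enter. From then on an arc removes from the guess
    the bit just verified. *)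
Definition tree_arc (k : 'I_#|node_set|) (c : bool) (t : vtx) : bool :=
  let: (i, w) := enum_val k in
  (level t == i.+1) &&
  (if i.+1 < h then state t == glue i w c [ffun=> false]
   else if i.+1 == h then F (glue i w c (state t))
   else w == glue i [ffun=> false] c (state t)).

Lemma level_arc u t : arc_rel tree_arc u t -> level t = (level u).+1.
Proof.
by case: u => [k|b] //=; rewrite /tree_arc; case: (enum_val k) => i w /=;
  case/orP => /andP[/eqP ->].
Qed.

Lemma tree_acyclic (c : seq vtx) : cycle (arc_rel tree_arc) c -> c = [::].
Proof.
have lvl p : forall u, path (arc_rel tree_arc) u p ->
    level (last u p) = level u + size p.
  elim: p => [|t p IHp] u /=; first by rewrite addn0.
  by case/andP=> /level_arc Et /IHp ->; rewrite Et addSnnS.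
by case: c => [|u c] //= /lvl; rewrite last_rcons size_rcons => ?; lia.
Qed.

Lemma vertex_eq u u' : level u = level u' -> state u = state u' -> u = u'.
Proof.
case: u u' => [k|b] [k'|b'] /=.
- move=> Ei Ew; congr inl; apply: enum_val_inj.
  by apply: injective_projections => //; apply: val_inj.
- by have := ltn_ord (enum_val k).1; case: b' => /= ? ?; lia.
- by have := ltn_ord (enum_val k').1; case: b => /= ? ?; lia.
by case: b b' => [] [] //= ?; lia.
Qed.

Lemma vertex_ex i a : i <= l -> exists u, level u = i /\ state u = mask i a.
Proof.
rewrite leq_eqVlt => /orP[/eqP ->|lt_il].
  exists (inr true); split=> //=; apply/ffunP=> j; rewrite !ffunE /known.
  by rewrite (ltnNge l) le_hl /= leqNgt ltn_ord andbF.
have Sx : (Ordinal lt_il, mask i a) \in node_set.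
  by rewrite inE /=; apply/eqP/ffunP=> j; rewrite !ffunE -andbA andbb.
exists (inl (enum_rank_in Sx (Ordinal lt_il, mask i a))).
by rewrite /= enum_rankK_in.
Qed.

(** The vertex at level [i] on the intended accepting path for [a]. For [i <= l] the default is
    never taken. *)
Definition canon (a : assignment 'I_l) i : vtx :=
  odflt (inr true) [pick u | (level u == i) && (state u == mask i a)].

Lemma canonP a i :
  i <= l -> level (canon a i) = i /\ state (canon a i) = mask i a.
Proof.
move=> le_il; rewrite /canon; case: pickP => [u /andP[/eqP ? /eqP ?] //|no_u].
have [u [Eu Ew]] := vertex_ex a le_il.
by have := no_u u; rewrite Eu Ew !eqxx.
Qed.

Lemma canon_last a : canon a l = inr true.
Proof.
have [Ei Ew] := canonP a (leqnn l); apply: vertex_eq => //.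
rewrite Ew; apply/ffunP=> j; rewrite !ffunE /known.
by rewrite (ltnNge l) le_hl /= leqNgt ltn_ord andbF.
Qed.


Definition universal_program : program X #|node_set| :=
  @Program X #|node_set| (fun k => e (enum_val k).1) (canon [ffun=> false] 0)
    tree_arc tree_acyclic.

(** * Uniqueness of the accepting path on a fixed input *)

Section FixedInput.
Variable a : assignment X.
Let b : assignment 'I_l := [ffun i => a (e i)].
Local Notation stp := (step universal_program a).

Lemma step_level u t : stp u t -> level u < l /\ level t = (level u).+1.
Proof.
case: u => [k|//] ut; split; first exact: ltn_ord.
apply: level_arc; move: ut => /=.
by case: (a _) => ->; rewrite ?orbT.
Qed.

Lemma stepE u t (lt_ul : level u < l) :
  stp u t = (level t == (level u).+1) &&
    (if (level u).+1 < h then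
       state t == glue (level u) (state u) (b (Ordinal lt_ul)) [ffun=> false]
     else if (level u).+1 == h then
       F (glue (level u) (state u) (b (Ordinal lt_ul)) (state t))
     else state u == glue (level u) [ffun=> false] (b (Ordinal lt_ul)) (state t)).
Proof.
case: u lt_ul => [k|[]] lt_ul /=; [|by exfalso; move: lt_ul => /=; lia..].
have -> : Ordinal lt_ul = (enum_val k).1 by apply: val_inj.
by rewrite /tree_arc ffunE; case: (enum_val k).
Qed.

Lemma glue_prefix i (lt_il : i < l) : i.+1 < h ->
  glue i (mask i b) (b (Ordinal lt_il)) [ffun=> false] = mask i.+1 b.
Proof.
move=> lt_ih; apply/ffunP=> j; rewrite !ffunE /known lt_ih (ltnW lt_ih) ltnS.
case: ltngtP => [?|?|Ej]; rewrite ?andbT ?andbF //.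
by congr (a (e _)); apply: val_inj.
Qed.

Lemma glue_middle i (lt_il : i < l) : i.+1 = h ->
  glue i (mask i b) (b (Ordinal lt_il)) (mask i.+1 b) = b.
Proof.
move=> Eh; apply/ffunP=> j; rewrite !ffunE /known Eh ltnn -Eh leqnn.
case: ltngtP => [?|?|Ej]; rewrite ?andbT //.
by congr (a (e _)); apply: val_inj.
Qed.

Lemma glue_suffix i (lt_il : i < l) : h <= i ->
  glue i [ffun=> false] (b (Ordinal lt_il)) (mask i.+1 b) = mask i b.
Proof.
move=> le_hi; apply/ffunP=> j; rewrite !ffunE /known !ltnNge leqW le_hi //= -!ltnNge.
case: ltngtP => [?|?|Ej]; rewrite ?andbT ?andbF //.
by congr (a (e _)); apply: val_inj.
Qed.

Lemma step_canon i : i < l -> F b -> stp (canon b i) (canon b i.+1).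
Proof.
move=> lt_il Fb; have [Ei Ew] := canonP b (ltnW lt_il).
have [Ei' Ew'] := canonP b lt_il.
have lt_cl : level (canon b i) < l by rewrite Ei.
rewrite (stepE _ lt_cl) Ei' Ew Ew'; move: lt_cl; rewrite Ei => lt_cl; rewrite eqxx /=.
case: ltngtP => [lt_ih|le_hi|Eh].
- by rewrite glue_prefix.
- by rewrite glue_suffix.
- by rewrite glue_middle.
Qed.

Lemma path_canon i n : i + n = l -> F b ->
  path stp (canon b i) (map (canon b) (iota i.+1 n)).
Proof.
move=> + Fb; elim: n i => //= n IHn i Eil.
by rewrite step_canon ?IHn //; lia.
Qed.

(** From level [h] on, the target of an arc and the bit read determine its source. The path is thus
    recovered backwards from t_1, and the guess must agree with the input. *)
Lemma path_suffix u p : h <= level u -> path stp u p -> last u p = inr true ->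
  u = canon b (level u) /\ p = map (canon b) (iota (level u).+1 (l - level u)).
Proof.
elim: p u => [|t p IHp] u /= le_hu.
  by move=> _ ->; rewrite /= canon_last subnn.
case/andP=> ut tp Elast.
have [lt_ul Et] := step_level ut.
have [|Ect Ep] := IHp t _ tp Elast; first by rewrite Et leqW.
have [_ Ew] := canonP b lt_ul; rewrite -Et -Ect in Ew.
have Eu : u = canon b (level u).
  have [Ei Ewu] := canonP b (ltnW lt_ul); apply: vertex_eq => //.
  move: ut; rewrite (stepE _ lt_ul) Et eqxx /=.
  case: ltngtP => [|_|]; [lia| |lia].
  by rewrite Ew Et glue_suffix // Ewu => /eqP.
split=> //; rewrite {1}Ect Ep Et.
by rewrite [l - level u](_ : _ = (l - (level u).+1).+1) //; lia.
Qed.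

(** Inside the decision tree the next vertex is forced. At the jump, [path_suffix] forces the guess
    to be correct, so the condition on that arc is [F b] itself. *)
Lemma path_prefix i p : i < h ->
    path stp (canon b i) p -> last (canon b i) p = inr true ->
  F b /\ p = map (canon b) (iota i.+1 (l - i)).
Proof.
elim: p i => [|t p IHp] i lt_ih /=.
  move=> _ /(congr1 level).
  by have [-> _] := canonP b (ltnW (leq_trans lt_ih le_hl)); move=> /=; lia.
case/andP=> ut tp Elast.
have lt_il := leq_trans lt_ih le_hl.
have [Ei Ew] := canonP b (ltnW lt_il).
have [Ei' Ew'] := canonP b lt_il.
have [lt_cl Et] := step_level ut.
move: (ut); rewrite (stepE _ lt_cl) Et eqxx Ew /=; move: lt_cl Et; rewrite Ei => lt_cl Et.
rewrite [l - i](_ : _ = (l - i.+1).+1) /=; last by lia.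
case: ltngtP => [lt_Sih|gt_ih|Eh].
- rewrite glue_prefix // => /eqP Ewt.
  have Ect : t = canon b i.+1 by apply: vertex_eq; rewrite ?Et ?Ewt.
  by rewrite Ect in tp Elast *; have [? ->] := IHp _ lt_Sih tp Elast.
- by rewrite ltnS leqNgt lt_ih in gt_ih.
have [|Ect Ep] := path_suffix _ tp Elast; first by rewrite Et Eh.
by rewrite Et in Ect Ep; rewrite Ep Ect Ew' glue_middle.
Qed.

(** Since no input has two accepting paths, existence and odd parity coincide, which serves both
    models. *)
Lemma accepting_path (p : seq (vertex #|node_set|)) :
  path stp (start universal_program) p &&
    (last (start universal_program) p == inr true)
  = F b && (p == map (canon b) (iota 1 l)).
Proof.
(* No bit is known at level 0, so the start vertex is the same for every input. *)
have -> : start universal_program = canon b 0.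
  have [Ei Ew] := canonP b (leq0n l).
  have [Ei0 Ew0] := canonP [ffun=> false] (leq0n l).
  apply: vertex_eq; rewrite /= ?Ei ?Ei0 // Ew Ew0.
  by apply/ffunP=> j; rewrite !ffunE /known h_gt0 /= andbF.
apply/andP/andP=> [[pp /eqP Elast]|[Fb /eqP ->]].
  by have [? ->] := path_prefix h_gt0 pp Elast; rewrite subn0.
split; first exact: path_canon.
have last_map n : last (canon b 0) (map (canon b) (iota 1 n)) = canon b n.
  by case: n => // n; rewrite -[n.+1]addn1 iotaD map_cat last_cat /= add1n addn1.
by rewrite last_map canon_last.
Qed.

(** Ensures that the accepting path, of length [l], is within the range of lengths summed in
    [num_paths]. *)
Lemma ltn_vertex : l < #|{: vtx}|.
Proof.
have canon_uniq : uniq (map (canon b) (iota 0 l.+1)).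
  rewrite map_inj_in_uniq ?iota_uniq // => i j.
  rewrite !mem_iota !add0n !ltnS /= => le_il le_jl /(congr1 level).
  by have [-> _] := canonP b le_il; have [-> _] := canonP b le_jl.
by have /card_uniqP := canon_uniq; rewrite size_map size_iota => <-; apply: max_card.
Qed.

Lemma universal_accepts M : accepts M universal_program a = F b.
Proof.
case: M => /=.
  apply/connectP/idP => [[p pp Elast]|Fb].
    by have := accepting_path p; rewrite pp -Elast eqxx => /esym/andP[].
  have := accepting_path (map (canon b) (iota 1 l)); rewrite Fb eqxx /=.
  by case/andP=> pp /eqP Elast; exists (map (canon b) (iota 1 l)).
rewrite /num_paths (eq_bigr (fun k : 'I__ => (F b && (k == l :> nat)) : nat)) => [|k _].
  rewrite (bigD1 (Ordinal ltn_vertex)) //= eqxx andbT big1 ?addn0 ?oddb //.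
  by move=> k ne_kl; rewrite -[k == l :> nat]/(k == Ordinal ltn_vertex) (negPf ne_kl) andbF.
under eq_finset => p do rewrite accepting_path.
case: (F b) => /=; last by apply: eq_card0 => p; rewrite inE.
by rewrite card_tuple_eq size_map size_iota.
Qed.
End FixedInput.

(** * Size of the program *)

Lemma leq_card_known (i : nat) : #|known i| <= (if i < h then i else l - i).
Proof.
pose r := if i < h then iota 0 i else iota i (l - i).
have -> : (if i < h then i else l - i) = size r by rewrite /r; case: ifP; rewrite size_iota.
rewrite cardE -(size_map (@nat_of_ord l)).
apply: uniq_leq_size; first by rewrite (map_inj_uniq (@ord_inj l)) enum_uniq.
move=> _ /mapP[j + ->]; rewrite mem_enum unfold_in /known /r.
case: ifP => _ ?; rewrite mem_iota // subnKC ?ltn_ord ?andbT //.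
by apply: leq_trans (ltnW (ltn_ord j)).
Qed.

Lemma leq_card_node_set : #|node_set| <= 2 ^ h + 2 ^ (l - h).+1.
Proof.
(* Count by levels: a state is free on the known bits and [false] elsewhere. Splitting at [h] then
   leaves two geometric sums. *)
have -> : #|node_set| = \sum_(i < l) 2 ^ #|known i|.
  rewrite -sum1_card (eq_bigl (fun x : 'I_l * assignment 'I_l =>
    true && (mask x.1 x.2 == x.2))); last first.
    by move=> x; rewrite inE eq_sym.
  rewrite -(pair_big_dep xpredT (fun (i : 'I_l) w => mask i w == w) (fun _ _ => 1)).
  apply: eq_bigr => i _; rewrite sum1_card -card_bool.
  rewrite -(card_pffun_on false); apply: eq_card => w.
  apply/idP/pffun_onP => [mask_w|[/supportP w0 _]].
    split=> //; apply/supportP=> j; rewrite unfold_in => /negPf nij.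
    have {mask_w} <- : mask i w = w := eqP (mask_w : mask i w == w).
    by rewrite ffunE /known nij andbF.
  suff /eqP : mask i w = w by [].
  apply/ffunP=> j; rewrite ffunE.
  by case: (boolP (known i j)) => [|/w0 ->]; rewrite ?andbT.
have -> : \sum_(i < l) 2 ^ #|known i| = \sum_(0 <= i < l) 2 ^ #|known i|.
  by rewrite big_mkord.
rewrite (big_cat_nat (leq0n h) le_hl) /=; apply: leq_add.
  apply: (@leq_trans (\sum_(0 <= i < h) 2 ^ i)).
    rewrite !big_nat; apply: leq_sum => i /= lt_ih; have := leq_card_known i.
    by rewrite lt_ih leq_exp2l.
  elim: (h) => [|m IHm]; first by rewrite big_geq.
  by rewrite big_nat_recr //= expnS mul2n -addnn leq_add2r.
apply: (@leq_trans (\sum_(h <= i < l) 2 ^ (l - i))).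
  rewrite !big_nat; apply: leq_sum => i /andP[le_hi _]; have := leq_card_known i.
  by rewrite ltnNge le_hi leq_exp2l.
move Ed: (l - h) => d.
have {Ed} : h + d = l by rewrite -Ed subnKC.
elim: d (h) => [|d IHd] m El; first by rewrite big_geq // -El addn0.
rewrite big_ltn; last by rewrite -El -addSnnS leq_addr.
rewrite (_ : l - m = d.+1); last by rewrite -El addKn.
by rewrite [leqRHS]expnS mul2n -addnn leq_add2l IHd // addSnnS.
Qed.

End UniversalProgram.

(** * Complexity bounds and numbers of functions *)

Lemma complexity_leq M (X : finType) l (e : 'I_l -> X) (F : boolfun 'I_l) :
  0 < l ->
  complexity M [ffun a : assignment X => F [ffun i => a (e i)]]
    <= 3 * 2 ^ uphalf l.
Proof.
move=> l_gt0.
have h_gt0 : 0 < uphalf l by rewrite uphalf_gt0.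
have le_hl : uphalf l <= l by lia.
apply: (@leq_trans #|node_set l (uphalf l)|).
  apply: nat_min_le; exists (universal_program e F h_gt0 le_hl) => a.
  by rewrite universal_accepts // ffunE.
apply: leq_trans (leq_card_node_set le_hl) _.
(* As [l - uphalf l <= uphalf l], the reversed tree contributes at most twice [2 ^ uphalf l]. *)
rewrite (mulnDl 1 2) mul1n leq_add2l expnS leq_mul2l /= leq_exp2l //; lia.
Qed.

(** Functions of [l] variables embed into those of [v] variables by ignoring all but the first
    [l]. *)
Lemma semantic_count_geq M v l : 0 < l -> l <= v ->
  2 ^ 2 ^ l <= semantic_count M v (3 * 2 ^ uphalf l).
Proof.
move=> l_gt0 le_lv.
pose ext (F : boolfun 'I_l) : boolfun 'I_v :=
  [ffun a : assignment 'I_v => F [ffun i => a (widen_ord le_lv i)]].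
have ext_inj : injective ext.
  move=> F G EFG; apply/ffunP=> c.
  pose a : assignment 'I_v := [ffun j => [exists i, (widen_ord le_lv i == j) && c i]].
  have Ec : c = [ffun i => a (widen_ord le_lv i)].
    apply/ffunP=> i; rewrite !ffunE; apply/idP/existsP => [ci|[j /andP[/eqP Eji cj]]].
      by exists i; rewrite eqxx.
    by rewrite (_ : i = j) //; apply: val_inj; have /= := congr1 val Eji.
  by have := congr1 (fun f : boolfun 'I_v => f a) EFG; rewrite !ffunE -Ec.
have <- : #|[set ext F | F in [set: boolfun 'I_l]]%SET| = 2 ^ 2 ^ l.
  by rewrite card_imset // finset.cardsT !card_ffun card_bool card_ord.
apply/subset_leq_card/fintype.subsetP=> _ /imsetP[F _ ->].
by rewrite inE complexity_leq.
Qed.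

(** The first bound counts all functions on [V], the second the assignments outside [V]. *)
Lemma num_subfunctions_leq n (f : boolfun 'I_n) (V : {set 'I_n}) :
  num_subfunctions f V <= 2 ^ 2 ^ #|V| /\ num_subfunctions f V <= 2 ^ n.
Proof.
split.
  apply: leq_trans (max_card _) _.
  by rewrite !card_ffun card_bool card_sig.
apply: leq_trans (leq_imset_card _ _) _.
by rewrite cardT -cardE card_ffun card_bool leq_exp2l // card_sig
  -[n in _ <= n]card_ord max_card.
Qed.

(** * Upper bound on the values the method can yield *)

Lemma exp_uphalf_ratio v l : 0 < v -> v <= l ->
  l * 2 ^ uphalf v <= 2 * v * 2 ^ uphalf l.
Proof.
move=> v_gt0 le_vl.
have [d Ed] : exists d, l = v + d by exists (l - v); lia.
(* Up to a factor 2, 2^(x/2) / x is non-decreasing: [l <= v * d.+1 <= 2 * v * d./2.+1] and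
   [d./2.+1 <= 2 ^ d./2]. *)
apply: (@leq_trans (v * (2 * d./2.+1) * 2 ^ uphalf v)).
  rewrite leq_mul2r; apply/orP; right; rewrite Ed.
  apply: (@leq_trans (v * d.+1)); first by nia.
  by rewrite leq_mul2l; apply/orP; right; lia.
rewrite mulnCA -!mulnA leq_mul2l /= leq_mul2l; apply/orP; right.
apply: (@leq_trans (2 ^ d./2 * 2 ^ uphalf v)).
  by rewrite leq_mul2r ltn_expl ?orbT.
by rewrite -expnD leq_exp2l //; lia.
Qed.

Lemma simple_neciporuk_bound_leq M n (g : boolfun 'I_n) k l :
  simple_neciporuk_bound M g k -> 0 < l -> n <= 2 ^ l ->
  l * k <= 7 * n * 2 ^ uphalf l.
Proof.
move=> [g_dep [b [P [[_ /(_ n g P g_dep) b_bound] partP ->]]]] l_gt0 le_n2l.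
have {}b_bound := b_bound partP.
have P_gt0 V : V \in P -> 0 < #|V|.
  move=> VP; rewrite card_gt0; apply: contraTneq VP => ->.
  by have /and3P[] := partP.
have sumP : \sum_(V in P) #|V| = n.
  by rewrite -(card_partition partP) finset.cardsT card_ord.
apply: leq_trans (leq_mul (leqnn l) b_bound) _.
have -> : 7 * n * 2 ^ uphalf l = \sum_(V in P) 7 * #|V| * 2 ^ uphalf l.
  by rewrite -big_distrl -big_distrr /= sumP.
rewrite big_distrr /=; apply: leq_sum => V VP.
have v_gt0 := P_gt0 V VP; set v := #|V| in v_gt0 *; set r := num_subfunctions g V.
rewrite maxnMr geq_max; apply/andP; split.
  (* The case of block size 1 gives [l <= 2 ^ uphalf l], which handles the term [#|V|]. *)
  have := exp_uphalf_ratio (leqnn 1) l_gt0.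
  by move=> /=; nia.
have m_gt0 : 0 < minn v l by rewrite leq_min v_gt0.
have r_leq : r <= 2 ^ 2 ^ minn v l.
  have [r_v r_n] := num_subfunctions_leq g V.
  rewrite /minn; case: ifP => // _.
  by apply: leq_trans r_n _; rewrite leq_exp2l.
(* Functions of [minn v l] variables are already numerous enough to reach [r], which bounds the
   inner minimum. *)
apply: (@leq_trans (l * (3 * 2 ^ uphalf (minn v l)))).
  rewrite leq_mul2l; apply/orP; right; apply: nat_min_le.
  exact: leq_trans r_leq (semantic_count_geq M m_gt0 (geq_minl v l)).
case: (leqP v l) => [/(exp_uphalf_ratio v_gt0)|lt_lv]; first by lia.
by rewrite mulnA leq_mul2r; apply/orP; right; lia.
Qed.

(** Squaring keeps the exponent 3/2 within the natural numbers; 196 is 7^2 * 4. *)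
Lemma simple_neciporuk_bound_sq M n (g : boolfun 'I_n) k l :
  simple_neciporuk_bound M g k -> 1 < n -> l = up_log 2 n ->
  (l * k) ^ 2 <= 196 * n ^ 3.
Proof.
move=> bound n_gt1 El.
have l_gt0 : 0 < l by rewrite El up_log_gt0.
have := simple_neciporuk_bound_leq bound l_gt0; rewrite {1}El up_logP // => /(_ isT) k_leq.
(* Here [2 * uphalf l <= l + 1], and [2 ^ l.-1 < n] because [l] is the rounded-up logarithm. *)
have pow_leq : (2 ^ uphalf l) ^ 2 <= 4 * n.
  rewrite -expnM; apply: (@leq_trans (2 ^ l.-1.+2)).
    by rewrite leq_exp2l //; lia.
  rewrite !expnS mulnA leq_mul2l /= ltnW // El.
  by have /andP[] := up_log_bounds (leqnn 2) n_gt1.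
apply: (@leq_trans ((7 * n * 2 ^ uphalf l) ^ 2)); first by rewrite leq_sqr.
by rewrite expnMn; move: pow_leq; set q := (_ ^ _) ^ _; nia.
Qed.

(** * Passage to the asymptotic bound over the reals *)

Local Open Scope classical_set_scope.
Local Open Scope ring_scope.

Theorem theorem3p8 (R : realType) (f : forall n : nat, boolfun 'I_n)
  (L : nat -> nat)
  (hL : forall n : nat,
     simple_neciporuk_bound NBP (f n) (L n) \/
     simple_neciporuk_bound ParityBP (f n) (L n)) :
  (fun n : nat => (L n)%:R : R) =O_\oo
  (fun n : nat => n%:R `^ (3 / 2) / (ln n%:R / ln 2) : R).
Proof.
(* The constant 14 is the square root of 196. *)
apply/eqOP; exists 14; split=> // k k_gt14; near=> n.
have n_gt1 : (1 < n)%N by near: n; exists 2%N.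
set l := up_log 2 n.
have sq_leq : ((l * L n) ^ 2 <= 196 * n ^ 3)%N.
  by have [] := hL n => /simple_neciporuk_bound_sq /(_ n_gt1 erefl).
have n_gt1R : 1 < n%:R :> R by rewrite ltr1n.
have ln2_gt0 : 0 < ln 2 :> R by rewrite ln_gt0 ?ltr1n.
have lnn_gt0 : 0 < ln n%:R :> R by rewrite ln_gt0.
(* Rounding the logarithm up is harmless: a bound on [l * L n] also bounds the product of [L n] with
   the real logarithm. *)
have log_leq : ln n%:R / ln 2 <= l%:R :> R.
  rewrite ler_pdivrMr // mulr_natl -lnXn // ler_ln ?posrE ?exprn_gt0 //.
    by rewrite -natrX ler_nat up_logP.
  exact: lt_trans n_gt1R.
have pow_sq : (n%:R `^ (3 / 2)) ^+ 2 = n%:R ^+ 3 :> R.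
  rewrite -powR_mulrn ?powR_ge0 // -powRrM -mulrA mulVf ?mulr1 //.
  by rewrite powR_mulrn // ler0n.
have main : (l * L n)%:R <= 14 * n%:R `^ (3 / 2) :> R.
  rewrite -(@ler_pXn2r _ 2) ?nnegrE ?mulr_ge0 ?powR_ge0 //.
  by rewrite exprMn pow_sq -!natrX -natrM ler_nat.
rewrite ger0_norm // ger0_norm; last by rewrite divr_ge0 ?powR_ge0 // divr_ge0 // ltW.
rewrite mulrA ler_pdivlMr ?divr_gt0 //.
apply: (@le_trans _ _ ((L n)%:R * l%:R)); first by rewrite ler_wpM2l.
rewrite -natrM mulnC (le_trans main) // ler_wpM2r ?powR_ge0 //.
exact: ltW.
Unshelve. all: by end_near. Qed.
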